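(* The set $\bigcup_{2\leq n<\omega}\mathrm{L}(n)$ is not spaceable in $\ell_\infty$; that is, $\bigcup_{2\leq n<\omega}\mathrm{L}(n)\cup\{0\}$ contains no closed infinite-dimensional linear subspace of $\ell_\infty$.
   Context: $\ell_\infty$ is the real Banach space of bounded real sequences $x=(x(n))_{n\in\omega}$ with the supremum norm, where $\omega=\{0,1,2,\dots\}$. For $x\in\ell_\infty$, a real $\eta$ is an accumulation point of $x$ if $\{n\in\omega: |x(n)-\eta|<\varepsilon\}$ is infinite for all $\varepsilon>0$; $\mathrm{L}_x$ denotes the set of accumulation points of $x$. For a cardinal $\kappa$, $\mathrm{L}(\kappa)=\{x\in\ell_\infty: |\mathrm{L}_x|=\kappa\}$. A subset $M$ of a topological vector space $X$ is spaceable in $X$ if $M\cup\{0\}$ contains a closed infinite-dimensional linear subspace of $X$. *)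

(* Defs.v *)
From HB Require Import structures.
From mathcomp Require Import all_boot all_order all_algebra.
From mathcomp Require Import boolp classical_sets functions cardinality.
From mathcomp Require Import reals topology normedtype sequences.

Set Implicit Arguments.
Unset Strict Implicit.
Unset Printing Implicit Defensive.

Import Order.TTheory GRing.Theory Num.Theory.
Import numFieldNormedType.Exports.

Local Open Scope classical_set_scope.
Local Open Scope card_scope.
Local Open Scope ring_scope.

Section LInfinity.
Variable R : realType.

Definition bounded_seq : {pred (nat -> R)} :=
  [pred x : nat -> R | `[<bounded_fun x>]].

Lemma bounded_seqP (x : nat -> R) :
  reflect (exists M, forall n, `|x n| <= M) (x \in bounded_seq).
Proof.
apply: (iffP (asboolP _)) => [[M [_ bM]]|[M bM]].
  by exists (M + 1) => n; apply: bM => //; rewrite ltrDl.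
exists M; split; first exact: num_real.
by move=> N /ltW MN n _; exact: le_trans (bM n) MN.
Qed.

Lemma bounded_seq_submod_closed : submod_closed bounded_seq.
Proof.
split; first by apply/bounded_seqP; exists 0 => n; rewrite normr0.
move=> a x y /bounded_seqP[M xM] /bounded_seqP[N yN]; apply/bounded_seqP.
exists (`|a| * M + N) => n; rewrite (le_trans (ler_normD _ _))// lerD//.
by rewrite normrM ler_wpM2l.
Qed.

HB.instance Definition _ :=
  GRing.isSubmodClosed.Build R (nat -> R) bounded_seq bounded_seq_submod_closed.

Record linf : Type :=
  Linf { linf_seq :> nat -> R ; linf_bounded : linf_seq \in bounded_seq }.

HB.instance Definition _ := [isSub for linf_seq].
HB.instance Definition _ := [Choice of linf by <:].
HB.instance Definition _ := [SubChoice_isSubLmodule of linf by <:].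

Definition linf_norm (x : linf) : R := sup (range (fun n => `|x n|)).

Lemma linf_has_sup (x : linf) : has_sup (range (fun n => `|x n|)).
Proof.
split; first by exists `|x 0%N|, 0%N.
by have /bounded_seqP[M xM] := linf_bounded x; exists M => _ [n _ <-].
Qed.

Lemma le_linf_norm (x : linf) n : `|x n| <= linf_norm x.
Proof. by apply: sup_upper_bound; [exact: linf_has_sup|exists n]. Qed.

Lemma linf_norm_le (x : linf) M : (forall n, `|x n| <= M) -> linf_norm x <= M.
Proof.
by move=> xM; apply: ge_sup; [exists `|x 0%N|, 0%N|move=> _ [n _ <-]].
Qed.

Lemma linf_normD (x y : linf) : linf_norm (x + y) <= linf_norm x + linf_norm y.
Proof.
apply: linf_norm_le => n; rewrite (le_trans (ler_normD (x n) (y n)))//.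
by rewrite lerD ?le_linf_norm.
Qed.

Lemma linf_normZ (a : R) (x : linf) : linf_norm (a *: x) = `|a| * linf_norm x.
Proof.
have leZ (b : R) (z : linf) : linf_norm (b *: z) <= `|b| * linf_norm z.
  apply: linf_norm_le => n.
  by rewrite [leLHS](normrM b (z n)) ler_wpM2l// le_linf_norm.
apply/eqP; rewrite eq_le leZ/=; have [->|a0] := eqVneq a 0.
  by rewrite normr0 mul0r (le_trans _ (le_linf_norm _ 0)).
rewrite -ler_pdivlMl ?normr_gt0// -normfV.
by rewrite -{1}(scalerK a0 x) leZ.
Qed.

Lemma linf_norm_eq0 (x : linf) : linf_norm x = 0 -> x = 0.
Proof.
move=> x0; apply/val_inj/funext => n /=; apply/eqP.
by rewrite -normr_le0 -x0 le_linf_norm.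
Qed.

HB.instance Definition _ :=
  Lmodule_isNormed.Build R linf linf_normD linf_normZ linf_norm_eq0.

Lemma linf_complete (F : set_system linf) :
  ProperFilter F -> cauchy F -> cvg F.
Proof.
move=> FF /cauchyP Fc.
have Fball e : 0 < e -> exists x : linf, F [set y | linf_norm (x - y) < e].
  by move=> e0; have [x Fx] := Fc e e0; exists x.
have cvgF n : cvg ((fun x : linf => x n : R) @ F).
  apply: R_complete; apply/cauchyP => e e0.
  have [x Fx] := Fball e e0; exists (x n).
  suff: F [set y : linf | ball (x n) e (y n)] by [].
  apply: filterS Fx => y /= xy; rewrite -ball_normE/=.
  by apply: le_lt_trans xy; exact: (le_linf_norm (x - y) n).
pose l n := lim ((fun x : linf => x n : R) @ F).
have lP e x n : F [set y | linf_norm (x - y) < e] -> `|x n - l n| <= e.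
  move=> Fx; rewrite leNgt; apply/negP => xle.
  have d0 : 0 < `|x n - l n| - e by rewrite subr_gt0.
  have Fl : F [set y : linf | `|l n - y n| < `|x n - l n| - e].
    by have /cvgrPdist_lt/(_ _ d0) := cvgF n.
  have [y [/= ly xy]] := filter_ex (filterI Fl Fx).
  have xyn : `|x n - y n| < e.
    by apply: le_lt_trans xy; exact: (le_linf_norm (x - y) n).
  have := lt_le_trans (ltrD xyn ly) (_ : _ <= `|x n - l n|).
  by rewrite addrC subrK lexx [X in _ + X]distrC ltNge ler_distD => /(_ isT).
have lb : l \in bounded_seq.
  have [x Fx] := Fball 1 ltr01; apply/bounded_seqP; exists (linf_norm x + 1) => n.
  rewrite -[l n](subKr (x n)) (le_trans (ler_normB _ _))// lerD ?le_linf_norm//.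
  exact: lP.
apply/cvg_ex; exists (Linf lb); apply/cvgrPdist_le => e e0.
have e20 : 0 < e / 2 by rewrite divr_gt0.
have [x Fx] := Fball _ e20; apply: filterS (Fx) => y /= xy.
apply: linf_norm_le => n; have := ler_distD (x n) (l n) (y n).
move/le_trans; apply; rewrite (splitr e) lerD//; first by rewrite distrC lP.
by apply/ltW/(le_lt_trans _ xy); exact: (le_linf_norm (x - y) n).
Qed.

HB.instance Definition _ := Uniform_isComplete.Build linf linf_complete.

End LInfinity.

Definition accumulation_points (R : realType) (x : nat -> R) : set R :=
  [set eta | forall e : R, 0 < e -> infinite_set [set n | `|x n - eta| < e]].

(* A cardinal is given by any set K of that cardinality. *)
Definition Lcard (R : realType) (U : Type) (K : set U) : set (linf R) :=
  [set x | accumulation_points x #= K].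

Definition finite_dimensional (K : numDomainType) (X : lmodType K)
    (V : set X) :=
  exists n (b : 'I_n -> X),
    V = range (fun c : 'I_n -> K => \sum_(i < n) c i *: b i).

Definition spaceable (K : numDomainType) (X : topologicalLmodType K)
    (M : set X) :=
  exists V : set X, [/\ submod_closed [in V], closed V,
    ~ finite_dimensional V & V `<=` M `|` [set 0]].

(* Main.v *)
From HB Require Import structures.
Require Import Defs.
From mathcomp Require Import all_boot all_order all_algebra.
From mathcomp Require Import boolp classical_sets functions cardinality.
From mathcomp Require Import reals topology normedtype sequences.

(** Evaluate bounded sequences by their limits along free ultrafilters: these
    limits are norm-decreasing linear functionals f with f x in L_x, and they
    attain every accumulation point. In a subspace V whose nonzero elements
    each have a nonzero accumulation point, infinite dimension allows to pick
    inductively v_n in V killed by f_0, ..., f_(n-1) but not by a new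
    functional f_n. A sum x of small multiples t_n v_n, with t_n chosen so
    that the value of f_n on the partial sum differs from those of
    f_0, ..., f_(n-1), then has infinitely many accumulation points f_n x. *)

Import Order.TTheory GRing.Theory Num.Theory.
Import numFieldNormedType.Exports.

Local Open Scope classical_set_scope.
Local Open Scope card_scope.
Local Open Scope ring_scope.

Lemma submod_closed_setP {K : numDomainType} {X : lmodType K} (W : set X) :
  submod_closed [in W] <->
  W 0 /\ forall a u v, W u -> W v -> W (a *: u + v).
Proof.
split=> -[W0 WD]; split; first exact: set_mem.
- by move=> a u v /mem_set Wu /mem_set Wv; apply/set_mem/WD.
- exact: mem_set.
- by move=> a u v /set_mem Wu /set_mem Wv; apply/mem_set/WD.
Qed.

Lemma submod_closed_ker {K : numDomainType} {X : lmodType K} (W : set X)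
    (f : {scalar X}) :
  submod_closed [in W] -> submod_closed [in W `&` f @^-1` [set 0]].
Proof.
move=> /submod_closed_setP[W0 WD]; apply/submod_closed_setP; split.
  by split=> //=; rewrite linear0.
move=> a u v [Wu /= fu] [Wv /= fv]; split; first exact: WD.
by rewrite /= linearP fu fv /= mulr0 addr0.
Qed.

(** A generating family of the kernel together with one [w] in [W] such that [f w != 0] generates
    [W]. Read contrapositively, infinite dimension survives each passage to a kernel. *)
Lemma finite_dimensional_ker {K : numFieldType} {X : lmodType K} (W : set X)
    (f : {scalar X}) :
  submod_closed [in W] -> finite_dimensional (W `&` f @^-1` [set 0]) ->
  finite_dimensional W.
Proof.
move=> /submod_closed_setP[W0 WD] [n [b Wb]].
have [[w Ww fw]|fW] := pselect (exists2 w, W w & f w != 0); last first.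
  exists n, b; rewrite -Wb; apply/seteqP; split=> [v Wv|v []//]; split=> //=.
  by apply/eqP/negP => /negP fv; apply: fW; exists v.
exists n.+1, (fun i => oapp b w (unlift ord0 i)).
apply/seteqP; split=> [v Wv|_ [c _ <-]].
  have : (W `&` f @^-1` [set 0]) (- (f v / f w) *: w + v).
    by split; [exact: WD|rewrite /= linearP /= mulNr divfK// addNr].
  rewrite Wb => -[c _ cE].
  exists (fun i => oapp c (f v / f w) (unlift ord0 i)) => //.
  rewrite big_ord_recl unlift_none /=; under eq_bigr do rewrite liftK /=.
  by rewrite cE scaleNr addNKr.
rewrite big_ord_recl unlift_none /=; apply: WD => //.
under eq_bigr do rewrite liftK /=.
have : range (fun c : 'I_n -> K => \sum_(i < n) c i *: b i)
  (\sum_(i < n) c (lift ord0 i) *: b i) by exists (c \o lift ord0).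
by rewrite -Wb => -[].
Qed.

Lemma infinite_dimensional_neq0 {K : numDomainType} {X : lmodType K}
    (W : set X) :
  W 0 -> ~ finite_dimensional W -> exists2 v, W v & v != 0.
Proof.
move=> W0 Wdim; apply: contrapT => noV; apply: Wdim.
exists 0%N, (fun=> 0); apply/seteqP; split=> [v Wv|_ [c _ <-]].
  exists (fun=> 0) => //; rewrite big_ord0; apply/esym/eqP/negP => /negP v0.
  by apply: noV; exists v.
by rewrite big_ord0.
Qed.

Definition limit_functional {R : realType} (f : {scalar linf R}) :=
  forall y : linf R, `|f y| <= `|y| /\ accumulation_points y (f y).

(* An accumulation point b of x makes the sets {n : |x n - b| < e}, up to
   finite sets, a filter basis; the limit along an ultrafilter refining it
   is the required functional. *)
Lemma exists_limit_functional {R : realType} (x : linf R) (b : R) :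
  accumulation_points x b -> exists2 f, limit_functional f & f x = b.
Proof.
move=> xb.
(* [F] contains every cofinite set, so no finite set lies in an ultrafilter refining it. *)
pose F : set_system nat := [set A | exists2 e : R, 0 < e &
  finite_set ([set n | `|x n - b| < e] `&` ~` A)].
have FF : ProperFilter F.
  split=> [[e e0]|]; first by rewrite setC0 setIT; exact: xb.
  split; first by exists 1 => //; rewrite setCT setI0.
    move=> A B [e e0 eA] [d d0 dB]; exists (Num.min e d).
      by rewrite lt_min e0.
    have := conj eA dB; rewrite -finite_setU; apply: sub_finite_set.
    move=> n [/=]; rewrite lt_min => /andP[ne nd] /not_andP[nA|nB].
      by left.
    by right.
  move=> A B AB [e e0 eA]; exists e => //; apply: sub_finite_set eA.
  by move=> n [ne nB]; split=> // /AB.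
have [U [UU FU]] := ultraFilterLemma FF.
have UF : ProperFilter U by exact: ultra_proper.
have limU (y : linf R) : exists p : R, `|p| <= `|y| /\ (y : nat -> R) @ U --> p.
  (* Compactness gives only a cluster point [p]; since [U] contains each set or its complement, [p]
     is a limit. *)
  have [|p [/= yp py]] := @segment_compact R (- `|y|) `|y| (y @ U) _.
    apply: (@filterS _ U _ setT); last exact: filterT.
    move=> n _ /=; rewrite in_itv /= -ler_norml.
    exact: (le_linf_norm y n).
  exists p; split; first by rewrite ler_norml; rewrite in_itv in yp.
  apply/cvgrPdistC_lt => e e0.
  have [//|UyC] := in_ultra_setVsetC [set n | `|y n - p| < e] UU.
  have [z [/= yz pz]] := py [set z | ~ `|z - p| < e] _ UyC (nbhsx_ballx p e e0).
  by case: yz; rewrite distrC.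
have [f fP] := choice limU.
have fE (y : linf R) p : (y : nat -> R) @ U --> p -> f y = p.
  by move=> yp; apply: cvg_unique yp => //; exact: (fP y).2.
have fl : scalar f.
  move=> a y z; apply: fE; apply: cvgD; last exact: (fP z).2.
  by apply: cvgMl_tmp; exact: (fP y).2.
exists (HB.pack f (GRing.isLinear.Build _ _ _ _ f fl) : {scalar linf R}).
  move=> y /=; split; first exact: (fP y).1.
  move=> e e0 fin.
  have Uy : U [set n | `|y n - f y| < e].
    by have [_ /cvgr_distC_lt/(_ _ e0)] := fP y.
  apply: (@filter_not_empty _ U); rewrite -(setICr [set n | `|y n - f y| < e]).
  apply: filterI => //; apply: FU; exists 1 => //; rewrite setCK.
  exact: finite_setIr.
apply: fE; apply/cvgrPdistC_lt => e e0; apply: FU; exists e => //.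
by rewrite setICr.
Qed.

Lemma injective_notin_seq {T : eqType} (g : nat -> T) (D : seq T) :
  injective g -> exists m, g m \notin D.
Proof.
move=> gI; apply: contrapT => gD.
have /(uniq_leq_size _) : {subset map g (iota 0 (size D).+1) <= D}.
  move=> _ /mapP[m _ ->]; apply/negPn/negP => gm; apply: gD; by exists m.
by rewrite map_inj_uniq// iota_uniq size_map size_iota ltnn => /(_ isT).
Qed.

(** For [v] in [W] with [f v = b != 0], the values of [f] at [t *: v + x] differ for different
    scalars [t], so the finite list [D] misses one of them. *)
Lemma extend_distinct_limits {R : realType} (W : set (linf R)) (x : linf R)
    (D : seq R) (e : R) :
  submod_closed [in W] -> ~ finite_dimensional W ->
  (forall v, W v -> v != 0 -> exists2 b, accumulation_points v b & b != 0) ->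
  0 < e -> exists f y,
  [/\ limit_functional f, W (y - x), `|y - x| <= e & f y \notin D].
Proof.
move=> /submod_closed_setP[W0 WD] Wdim Wacc e0.
have [v Wv v0] := infinite_dimensional_neq0 W W0 Wdim.
have [b vb b0] := Wacc v Wv v0.
have [f fL fv] := exists_limit_functional _ _ vb.
have nv0 : 0 < `|v| by rewrite normr_gt0.
(* With this choice [t m *: v] has norm [e / m.+1], at most [e]. *)
pose t (m : nat) : R := e / `|v| / m.+1%:R.
have [|m mD] := injective_notin_seq (fun m => f (t m *: v + x)) D.
  move=> m n; rewrite !linearP fv /= => /addIr/(mulIf b0) /mulfI.
  move=> /(_ (lt0r_neq0 (divr_gt0 e0 nv0)))/invr_inj/eqP.
  by rewrite eqr_nat => /eqP[].
exists f, (t m *: v + x); split => //.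
  by rewrite addrK -[_ *: _]addr0; exact: WD.
rewrite addrK normrZ ger0_norm; last by rewrite !divr_ge0// ltW.
rewrite /t mulrAC divfK ?gt_eqF// ler_pdivrMr// ler_peMr ?ler1n//.
exact: ltW.
Qed.

(* The perturbations x_{n+1} - x_n lie in subspaces on which the functionals
   chosen before step n vanish, so the distinct values obtained so far are
   never altered, even in the limit. *)
Lemma exists_infinite_accumulation_points {R : realType} (V : set (linf R)) :
  submod_closed [in V] -> closed V -> ~ finite_dimensional V ->
  (forall v, V v -> v != 0 -> exists2 b, accumulation_points v b & b != 0) ->
  exists2 x, V x & infinite_set (accumulation_points x).
Proof.
move=> Vmod Vcl Vdim Vacc.
have /submod_closed_setP[V0 VD] := Vmod.
(* A state holds the current subspace, the partial sum and the values obtained so far; the length of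
   the list counts the steps. *)
pose X : Type := (set (linf R) * linf R * seq R)%type.
pose good (p : X) := [/\ submod_closed [in p.1.1], ~ finite_dimensional p.1.1 &
  p.1.1 `<=` V].
pose next (p q : X) := exists f, [/\ limit_functional f,
  p.1.1 (q.1.2 - p.1.2), `|q.1.2 - p.1.2| <= 1 / (2 ^ (size p.2 + 1))%:R,
  f q.1.2 \notin p.2 & q.1.1 = p.1.1 `&` f @^-1` [set 0] /\
  q.2 = f q.1.2 :: p.2].
(* Conditioning on [good p] gives every state a successor, as dependent choice requires. *)
pose step (p q : X) := good p -> good q /\ next p q.
have stepP p : {q | step p q}.
  apply: cid; have [pg|] := pselect (good p); last by exists p.
  case: p pg => [[W x] D] [/= Wmod Wdim WV].
  have [||f [y [fL Wyx yx yD]]] :=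
    extend_distinct_limits W x D (1 / (2 ^ (size D + 1))%:R) Wmod Wdim.
  - by move=> v /WV; exact: Vacc.
  - by rewrite divr_gt0// ltr0n expn_gt0.
  exists (W `&` f @^-1` [set 0], y, f y :: D) => _; split; last by exists f.
  split => /=; [exact: submod_closed_ker| |by move=> z [/WV]].
  by move=> /(finite_dimensional_ker _ _ Wmod).
have [u [u0 uS]] :=
  @dependent_choice X step stepP (V, 0, [::]).
have ug n : good (u n) by elim: n => [|n /uS[]//]; rewrite u0; split.
have [f fP] := choice (fun n => (uS n (ug n)).2).
pose W n := (u n).1.1; pose x n := (u n).1.2; pose D n := (u n).2.
have Wmod n := (submod_closed_setP (W n)).1 (let: And3 h _ _ := ug n in h).
have WS n : W n.+1 = W n `&` f n @^-1` [set 0] by have [_ _ _ _ []] := fP n.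
have DS n : D n.+1 = f n (x n.+1) :: D n by have [_ _ _ _ []] := fP n.
have sizeD n : size (D n) = n.
  by elim: n => [|n IHn]; [rewrite /D u0|rewrite DS /= IHn].
have xW n k : W n (x (n + k)%N - x n).
  suff : W n (x (n + k)%N - x n) /\ W (n + k)%N `<=` W n by case.
  elim: k => [|k [IHx IHW]].
    by rewrite addn0 subrr; split=> //; exact: (Wmod n).1.
  rewrite addnS; split; last by rewrite WS => z [/IHW].
  rewrite -[_ - _](subrKA (x (n + k)%N)) -[X in X + _]scale1r.
  by apply: (Wmod n).2 => //; apply: IHW; have [] := fP (n + k)%N.
have xV n : V (x n).
  by have := xW 0%N n; rewrite /W /x u0 subr0.
have fx n k : f n (x (n.+1 + k)%N) = f n (x n.+1).
  have := xW n.+1 k; rewrite WS => -[_] /=; rewrite linearB => /eqP.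
  by rewrite subr_eq0 => /eqP.
have fD n k : f n (x n.+1) \in D (n.+1 + k)%N.
  elim: k => [|k IHk]; first by rewrite addn0 DS mem_head.
  by rewrite addnS DS in_cons IHk orbT.
have fI : injective (fun n => f n (x n.+1)).
  suff fneq m n : (m < n)%N -> f m (x m.+1) <> f n (x n.+1).
    by move=> m n mn; have [/fneq|/fneq /(_ (esym mn))|//] := ltngtP m n.
  move=> mn E; have [_ _ _ /negP + _] := fP n; apply.
  by rewrite -/(x _) -E -/(D _) -(subnKC mn) fD.
(* The increments have norm at most [1 / 2 ^ (k + 1)], so their series converges absolutely. *)
have [l xl] : exists l : linf R, x n @[n --> \oo] --> l.
  suff : cvgn (series (telescope x)).
    move=> /cvg_ex[l]; rewrite telescopeK => lP; exists (l + x 0%N).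
    rewrite -[x in x @ _](_ : (fun n => (x n - x 0%N) + x 0%N) = x).
      by apply: cvgD => //; exact: cvg_cst.
    by apply/funext => n; rewrite subrK.
  apply: normed_cvg.
  apply: (@series_le_cvg _ _ (fun k => 1 / (2 ^ (k + 1))%:R)) => [k|k|k|].
  - exact: normr_ge0.
  - by rewrite divr_ge0.
  - by have [_ _ + _ _] := fP k; rewrite -/(D _) sizeD.
  - by apply/cvg_ex; exists (1 / 2 ^+ 0); exact: cvg_geometric_series_half.
exists l; first by apply: (closed_cvg V Vcl _ l xl); exact: nearW.
(* Being norm-decreasing, [f n] is continuous, and it is constant along the tail of [x]. *)
have fl n : f n l = f n (x n.+1).
  apply/eqP; rewrite -subr_eq0 -normr_le0; apply/ler_addgt0Pl => e e0.
  rewrite addr0.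
  have /cvgrPdist_lt/(_ _ e0)[N _ NP] := xl.
  have /ltW := NP (n.+1 + N)%N (leq_addl _ _); apply: le_trans.
  rewrite -(fx n N) -linearB; have [fL _ _ _ _] := fP n.
  by have [] := fL (l - x (n.+1 + N)%N).
apply/infiniteP; rewrite -(card_le_eql (inj_card_eq (in2W fI))).
apply: subset_card_le => _ [n _ <-]; rewrite -fl.
by have [fL _ _ _ _] := fP n; have [] := fL l.
Qed.

Theorem theorem4p6 (R : realType) :
  ~ @spaceable R (linf R)
      (\bigcup_(n in [set n : nat | (2 <= n)%N]) @Lcard R nat `I_n).
Proof.
move=> [V [Vmod Vcl Vdim VM]].
have acc0 : accumulation_points (0 : linf R) `<=` [set 0].
  move=> b b0; apply/eqP/negPn/negP => bn0.
  apply: (b0 `|b|); first by rewrite normr_gt0.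
  apply: (@sub_finite_set _ _ set0) => // n /=.
  by rewrite sub0r normrN ltxx.
have [|x Vx xinf] := exists_infinite_accumulation_points V Vmod Vcl Vdim.
  move=> v Vv v0; apply: contrapT => vacc.
  have [[n /= n2 vn]|/= v0'] := VM v Vv; last by rewrite v0' eqxx in v0.
  (* Without a nonzero accumulation point, the at least two points of L_v would all lie in {0}. *)
  have : `I_2 #<= [set (0 : R)].
    apply: (card_le_trans _ (subset_card_le _ : accumulation_points v #<= _)).
      by rewrite (card_le_eqr vn) card_le_II.
    by move=> b vb; apply/eqP/negPn/negP => b0; apply: vacc; exists b.
  by rewrite (card_le_eqr card_set1) card_le_II.
have [[n _ xn]|x0] := VM x Vx.
  by apply: xinf; apply/finite_setP; exists n.
by apply: xinf; rewrite x0; apply: sub_finite_set acc0 _.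
Qed.
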